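(* Let the setting and standing assumptions of the context hold and let $\rho^*>0$ be a constant such that $$\sup_{\mathbf y\in\mathcal Y}\ \inf_{\omega_1\in\partial p_{\mathbf y}(0)}\|\omega_1\|\le\rho^*\qquad\text{and}\qquad\sup_{\mathbf x\in\mathcal X}\ \inf_{\omega_2\in\partial q_{\mathbf x}(0)}\|\omega_2\|\le\rho^*.$$ Let $\epsilon>0$. Then any $(\bar{\mathbf x},\bar{\mathbf y})\in\mathcal X\times\mathcal Y$ satisfying $$\max_{\mathbf y\in\mathcal Y,\,B\mathbf y=b}\Phi(\bar{\mathbf x},\mathbf y)-\min_{\mathbf x\in\mathcal X,\,A\mathbf x=a}\Phi(\mathbf x,\bar{\mathbf y})+\rho\|A\bar{\mathbf x}-a\|+\rho\|B\bar{\mathbf y}-b\|\le\epsilon$$ for some $\rho>\rho^*$ is an $\mathcal O(\epsilon)$-saddle point, i.e. a $C\epsilon$-saddle point for a constant $C$ depending only on $\rho$ and $\rho^*$.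
   Context: **Problem.** $\min_{\mathbf x\in\mathcal X}\max_{\mathbf y\in\mathcal Y}\Phi(\mathbf x,\mathbf y)$ subject to $A\mathbf x=a$, $B\mathbf y=b$, where $\mathcal X=\mathcal X_1\times\cdots\times\mathcal X_N\subset\mathbb R^{d_{\mathbf x}}$ and $\mathcal Y=\mathcal Y_1\times\cdots\times\mathcal Y_M\subset\mathbb R^{d_{\mathbf y}}$ are products of compact convex sets, $A\in\mathbb R^{n\times d_{\mathbf x}}$, $B\in\mathbb R^{m\times d_{\mathbf y}}$, $a\in\mathbb R^n$, $b\in\mathbb R^m$, and $\Phi(\mathbf x,\mathbf y)=\sum_ih_i(x_i)+\Psi(\mathbf x,\mathbf y)-\sum_jg_j(y_j)$. **Standing assumptions.** $\Phi(\cdot,\mathbf y)$ is convex and lower semicontinuous on $\mathcal X$ for every $\mathbf y\in\mathcal Y$; $\Phi(\mathbf x,\cdot)$ is concave and upper semicontinuous on $\mathcal Y$ for every $\mathbf x\in\mathcal X$; $\Phi$ is bounded on $\mathcal X\times\mathcal Y$. Slater's condition: there is $(\hat{\mathbf x},\hat{\mathbf y})\in\mathrm{int}(\mathcal X)\times\mathrm{int}(\mathcal Y)$ with $A\hat{\mathbf x}=a$, $B\hat{\mathbf y}=b$. **Perturbation functions.** For $\mathbf x\in\mathcal X,\mathbf y\in\mathcal Y$, $$p_{\mathbf y}(v)=\min_{\mathbf x\in\mathcal X,\,A\mathbf x-a=v}\Phi(\mathbf x,\mathbf y),\qquad q_{\mathbf x}(u)=\max_{\mathbf y\in\mathcal Y,\,B\mathbf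 y-b=u}\Phi(\mathbf x,\mathbf y)$$ (with values $+\infty$, $-\infty$ respectively if infeasible); $p_{\mathbf y}$ is convex and $q_{\mathbf x}$ concave; $\partial p_{\mathbf y}$ is the subdifferential and $\partial q_{\mathbf x}$ the superdifferential. **$\epsilon$-saddle point.** $(\bar{\mathbf x},\bar{\mathbf y})\in\mathcal X\times\mathcal Y$ is an $\epsilon$-saddle point if $\max_{\mathbf y\in\mathcal Y,B\mathbf y=b}\Phi(\bar{\mathbf x},\mathbf y)-\min_{\mathbf x\in\mathcal X,A\mathbf x=a}\Phi(\mathbf x,\bar{\mathbf y})\in[-\epsilon,\epsilon]$, $\|A\bar{\mathbf x}-a\|\le\epsilon$ and $\|B\bar{\mathbf y}-b\|\le\epsilon$. Norms are Euclidean. *)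

(* Defs.v *)
From HB Require Import structures.
From mathcomp Require Import all_boot all_order all_algebra.
From mathcomp Require Import all_classical all_reals all_analysis.

Set Implicit Arguments.
Unset Strict Implicit.
Unset Printing Implicit Defensive.

Import Order.TTheory GRing.Theory Num.Theory numFieldNormedType.Exports.

Local Open Scope classical_set_scope.
Local Open Scope convex_scope.
Local Open Scope ring_scope.

Definition dotcv (R : realType) (k : nat) (u v : 'cV[R]_k) : R :=
  \sum_(i < k) u i 0 * v i 0.

(* The library's norm on matrices is the sup norm, hence a separate Euclidean
   norm. Both induce the same topology, so compactness, interiors and
   semicontinuity below are stated with the library's topology on 'cV[R]_k. *)
Definition enorm (R : realType) (k : nat) (v : 'cV[R]_k) : R :=
  Num.sqrt (dotcv v v).

(* Mirror images of [lower_semicontinuous] and [convex_function]. *)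
Definition upper_semicontinuous (T : topologicalType) (R : realType)
    (f : T -> \bar R) : Prop :=
  forall x a, (f x < a%:E)%E ->
    exists2 V, nbhs x V & forall y, V y -> (f y < a%:E)%E.

Definition concave_function (R : realType) (E : lmodType R)
    (E' := convex_lmodType E) (D : set E') (f : E' -> R^o) : Prop :=
  forall t : {i01 R},
    {in D &, forall x y : E', f x <| t |> f y <= f (x <| t |> y)}.

(* [subspace D] carries the topology in which semicontinuity at the points of
   D is tested along D only, and is automatic at the points outside D. *)
Definition lsc_on (R : realType) (T : topologicalType) (D : set T)
    (f : T -> R) : Prop :=
  lower_semicontinuous (fun x : subspace D => (f x)%:E).

Definition usc_on (R : realType) (T : topologicalType) (D : set T)
    (f : T -> R) : Prop :=
  upper_semicontinuous (fun x : subspace D => (f x)%:E).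

Definition subdifferential (R : realType) (k : nat) (f : 'cV[R]_k -> \bar R)
    (v0 : 'cV[R]_k) : set 'cV[R]_k :=
  [set w | f v0 \is a fin_num /\
    forall v, (f v0 + (dotcv w (v - v0))%:E <= f v)%E].

Definition superdifferential (R : realType) (k : nat) (f : 'cV[R]_k -> \bar R)
    (v0 : 'cV[R]_k) : set 'cV[R]_k :=
  [set w | f v0 \is a fin_num /\
    forall v, (f v <= f v0 + (dotcv w (v - v0))%:E)%E].

(* The i-th block x_i of x is [submxcol x i]. *)
Record minimax (R : realType) : Type := Minimax {
  numX : nat;
  numY : nat;
  dimX : 'I_numX -> nat;
  dimY : 'I_numY -> nat;
  blockX : forall i, set 'cV[R]_(dimX i);
  blockY : forall j, set 'cV[R]_(dimY j);
  termX : forall i, 'cV[R]_(dimX i) -> R;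
  termY : forall j, 'cV[R]_(dimY j) -> R;
  coupling : 'cV[R]_(\sum_i dimX i) -> 'cV[R]_(\sum_j dimY j) -> R;
  nconX : nat;
  nconY : nat;
  matA : 'M[R]_(nconX, \sum_i dimX i);
  vecA : 'cV[R]_nconX;
  matB : 'M[R]_(nconY, \sum_j dimY j);
  vecB : 'cV[R]_nconY }.

Section Minimax.
Variables (R : realType) (P : minimax R).

Notation vecX := 'cV[R]_(\sum_i @dimX R P i).
Notation vecY := 'cV[R]_(\sum_j @dimY R P j).

Definition domX : set vecX := [set x | forall i, blockX (submxcol x i)].
Definition domY : set vecY := [set y | forall j, blockY (submxcol y j)].

Definition resA (x : vecX) : 'cV[R]_(nconX P) := matA P *m x - vecA P.
Definition resB (y : vecY) : 'cV[R]_(nconY P) := matB P *m y - vecB P.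

Definition Phi (x : vecX) (y : vecY) : R :=
  \sum_i termX (submxcol x i) + coupling x y - \sum_j termY (submxcol y j).

Definition slater : Prop :=
  exists x y, [/\ domX^° x, domY^° y, matA P *m x = vecA P
                & matB P *m y = vecB P].

Record standing_assumptions : Prop := StandingAssumptions {
  compact_blockX : forall i, compact (@blockX R P i);
  convex_blockX : forall i, convex_set (@blockX R P i);
  compact_blockY : forall j, compact (@blockY R P j);
  convex_blockY : forall j, convex_set (@blockY R P j);
  convex_Phi : forall y, domY y -> convex_function domX (Phi^~ y);
  lsc_Phi : forall y, domY y -> lsc_on domX (Phi^~ y);
  concave_Phi : forall x, domX x -> concave_function domY (Phi x);
  usc_Phi : forall x, domX x -> usc_on domY (Phi x);
  bounded_Phi : exists K : R,
    forall x y, domX x -> domY y -> `|Phi x y| <= K;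
  slater_condition : slater }.

(* The extrema below are over compact sets on which the objective is
   semicontinuous, hence attained as soon as the problem is feasible. On an
   infeasible problem ereal_inf is +oo and ereal_sup is -oo. *)
Definition pertX (y : vecY) (v : 'cV[R]_(nconX P)) : \bar R :=
  ereal_inf [set (Phi x y)%:E | x in [set x | domX x /\ resA x = v]].

Definition pertY (x : vecX) (u : 'cV[R]_(nconY P)) : \bar R :=
  ereal_sup [set (Phi x y)%:E | y in [set y | domY y /\ resB y = u]].

Definition feasible_min (y : vecY) : \bar R :=
  ereal_inf [set (Phi x y)%:E
            | x in [set x | domX x /\ matA P *m x = vecA P]].

Definition feasible_max (x : vecX) : \bar R :=
  ereal_sup [set (Phi x y)%:E
            | y in [set y | domY y /\ matB P *m y = vecB P]].

Definition gap (x : vecX) (y : vecY) : \bar R :=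
  (feasible_max x - feasible_min y)%E.

(* The inner infimum is +oo when the sub- or superdifferential is empty, so
   the bounds force these to be nonempty. *)
Definition multiplier_bound (rhos : R) : Prop :=
  (ereal_sup [set ereal_inf [set (enorm w)%:E | w in subdifferential (pertX y) 0%R]
             | y in domY] <= rhos%:E)%E /\
  (ereal_sup [set ereal_inf [set (enorm w)%:E | w in superdifferential (pertY x) 0%R]
             | x in domX] <= rhos%:E)%E.

Definition eps_saddle (eps : R) (x : vecX) (y : vecY) : Prop :=
  [/\ domX x, domY y, ((- eps)%:E <= gap x y <= eps%:E)%E,
      enorm (resA x) <= eps & enorm (resB y) <= eps].

End Minimax.

(* Main.v *)
Require Import Defs.
From mathcomp Require Import all_boot all_order all_algebra.
From mathcomp Require Import all_classical all_reals all_analysis.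
From mathcomp Require Import ring lra.

Set Implicit Arguments.
Unset Strict Implicit.
Unset Printing Implicit Defensive.

Import Order.TTheory GRing.Theory Num.Theory numFieldNormedType.Exports.

Local Open Scope ring_scope.

(** A subgradient w of f at 0 gives the linear minorant f v >= f 0 + <w, v>, so
    one of norm at most r gives f v >= f 0 - r |v| ([subdifferential_lower_bound]).
    Since pertX y is at most Phi x y at the residual of x, a subgradient of
    pertX y and a supergradient of pertY x, both of norm at most r, sandwich
    Phi x y:
<<
    min_{Ax = a} Phi(., y) - r |Ax - a| <= Phi x y
                                        <= max_{By = b} Phi(x, .) + r |By - b|
>>
    Writing S for |Ax - a| + |By - b|, this says that the gap is at least - r S.
    The hypothesis says that the gap is at most eps - rho S. Hence
    (rho - r) S <= eps, which bounds both residuals, and the gap lies between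
    - r eps / (rho - r) and eps. The infimum of the norms of subgradients is
    not asserted to be attained, so r is the midpoint of rhos and rho rather
    than rhos itself; this makes rho - r half of rho - rhos. *)

Section Euclidean.
Context (R : realType) (k : nat).
Implicit Types u v w : 'cV[R]_k.

Lemma dotcvv_ge0 v : 0 <= dotcv v v.
Proof. by apply: sumr_ge0 => i _; rewrite -expr2 sqr_ge0. Qed.

Lemma enorm_ge0 v : 0 <= enorm v.
Proof. exact: sqrtr_ge0. Qed.

Lemma sqr_enorm v : enorm v ^+ 2 = dotcv v v.
Proof. by rewrite sqr_sqrtr // dotcvv_ge0. Qed.

Lemma enorm_eq0 v : enorm v = 0 -> v = 0.
Proof.
move=> v0; apply/colP => i; rewrite mxE; apply/eqP.
have /eqP : dotcv v v = 0 by rewrite -sqr_enorm v0 expr0n.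
rewrite psumr_eq0 => [/allP /(_ i)|j _]; last by rewrite -expr2 sqr_ge0.
by rewrite mem_index_enum mulf_eq0 orbb => /(_ isT).
Qed.

Lemma dotcv_comb (a b : R) w v :
  dotcv (a *: w + b *: v) (a *: w + b *: v) =
  a ^+ 2 * dotcv w w + 2 * (a * b * dotcv w v) + b ^+ 2 * dotcv v v.
Proof.
rewrite /dotcv !mulr_sumr -!big_split; apply: eq_bigr => i _ /=.
by rewrite !mxE; ring.
Qed.

(** Cauchy-Schwarz inequality: with a = |v|, b = |w| and c = +1 or -1, the
    square of the norm of a w + c b v is 2 a b (a b + c <w, v>). *)
Lemma cauchy_schwarz w v : `|dotcv w v| <= enorm w * enorm v.
Proof.
have [w0|wN0] := eqVneq (enorm w) 0.
  rewrite w0 (enorm_eq0 w0) mul0r /dotcv big1 ?normr0 // => i _.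
  by rewrite mxE mul0r.
have [v0|vN0] := eqVneq (enorm v) 0.
  rewrite v0 (enorm_eq0 v0) mulr0 /dotcv big1 ?normr0 // => i _.
  by rewrite mxE mulr0.
have wv_gt0 : 0 < enorm w * enorm v.
  by rewrite mulr_gt0 // lt0r ?wN0 ?vN0 enorm_ge0.
rewrite ler_norml -(ler_pM2l wv_gt0) -(ler_pM2l wv_gt0 (dotcv w v)).
have := dotcvv_ge0 (enorm v *: w + enorm w *: v).
have := dotcvv_ge0 (enorm v *: w + (- enorm w) *: v).
rewrite !dotcv_comb -!sqr_enorm => h1 h2.
by apply/andP; split; lra.
Qed.

End Euclidean.

Section Gradients.
Context (R : realType) (k : nat).
Implicit Types (f : 'cV[R]_k -> \bar R) (v w : 'cV[R]_k) (r : R).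

Lemma subdifferential_lower_bound f v0 w r v :
  subdifferential f v0 w -> enorm w <= r ->
  (f v0 - (r * enorm (v - v0))%:E <= f v)%E.
Proof.
move=> [_ /(_ v) fv] wr; apply: le_trans fv.
rewrite -EFinN leeD2l // lee_fin lerNl (le_trans (ler_norm _)) // normrN.
by rewrite (le_trans (cauchy_schwarz _ _)) // ler_wpM2r // enorm_ge0.
Qed.

Lemma superdifferential_upper_bound f v0 w r v :
  superdifferential f v0 w -> enorm w <= r ->
  (f v <= f v0 + (r * enorm (v - v0))%:E)%E.
Proof.
move=> [_ /(_ v) fv] wr; apply: le_trans fv _.
rewrite leeD2l // lee_fin (le_trans (ler_norm _)) //.
by rewrite (le_trans (cauchy_schwarz _ _)) // ler_wpM2r // enorm_ge0.
Qed.

(** A bound on a supremum of infima yields, for each index, an element whose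
    norm is below any strictly larger bound. *)
Lemma sup_inf_enorm_lt (T : Type) (D : set T) (S : T -> set 'cV[R]_k)
    (a b : R) t :
  (ereal_sup [set ereal_inf [set (enorm w)%:E | w in S s] | s in D]
     <= a%:E)%E ->
  a < b -> D t -> exists2 w, S t w & enorm w < b.
Proof.
move=> supa ab Dt.
have inf_lt : (ereal_inf [set (enorm w)%:E | w in S t] < b%:E)%E.
  apply: (@le_lt_trans _ _ a%:E); last by rewrite lte_fin.
  by apply: le_trans supa; apply: ereal_sup_ubound; exists t.
by have [_ [w Sw <-] wb] := ereal_inf_lt inf_lt; exists w.
Qed.

End Gradients.

Section Perturbation.
Context (R : realType) (P : minimax R).
Implicit Types (x : 'cV[R]_(\sum_i @dimX R P i))
               (y : 'cV[R]_(\sum_j @dimY R P j)).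

Lemma feasible_minE y : feasible_min y = pertX y 0.
Proof.
congr (ereal_inf (image _ _)); apply/seteqP.
by split => x /= [Dx /eqP h]; split=> //; apply/eqP; rewrite ?subr_eq0 // -subr_eq0.
Qed.

Lemma feasible_maxE x : feasible_max x = pertY x 0.
Proof.
congr (ereal_sup (image _ _)); apply/seteqP.
by split => y /= [Dy /eqP h]; split=> //; apply/eqP; rewrite ?subr_eq0 // -subr_eq0.
Qed.

Lemma feasible_min_le_Phi x y w r : domX x ->
  subdifferential (pertX y) 0 w -> enorm w <= r ->
  (feasible_min y - (r * enorm (resA x))%:E <= (Phi x y)%:E)%E.
Proof.
move=> Dx dw wr; rewrite feasible_minE -[resA x]subr0.
apply: le_trans (subdifferential_lower_bound _ dw wr) _.
by apply: ereal_inf_lbound; exists x.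
Qed.

Lemma Phi_le_feasible_max x y w r : domY y ->
  superdifferential (pertY x) 0 w -> enorm w <= r ->
  ((Phi x y)%:E <= feasible_max x + (r * enorm (resB y))%:E)%E.
Proof.
move=> Dy dw wr; rewrite feasible_maxE -[resB y]subr0.
apply: le_trans (superdifferential_upper_bound _ dw wr).
by apply: ereal_sup_ubound; exists y.
Qed.

End Perturbation.

Theorem lemma2p4 (R : realType) (rhos rho : R)
    (hrhos : 0 < rhos) (hrho : rhos < rho) :
  exists2 C : R, 0 < C &
    forall P : minimax R,
      standing_assumptions P -> multiplier_bound P rhos ->
      forall eps : R, 0 < eps ->
      forall (x : 'cV[R]_(\sum_i @dimX R P i))
             (y : 'cV[R]_(\sum_j @dimY R P j)),
        domX x -> domY y ->
        (gap x y + (rho * enorm (resA x))%:E + (rho * enorm (resB y))%:E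
           <= eps%:E)%E ->
        eps_saddle (C * eps) x y.
Proof.
pose r := (rhos + rho) / 2.
have r_gt0 : 0 < r by rewrite /r; lra.
have rhos_r : rhos < r by rewrite /r; lra.
have d_gt0 : 0 < rho - r by rewrite /r; lra.
(* The three summands bound the gap from above, the residuals, and the gap
   from below. *)
exists (1 + (rho - r)^-1 + r / (rho - r)).
  have dV_gt0 : 0 < (rho - r)^-1 by rewrite invr_gt0.
  by apply: addr_gt0; [apply: addr_gt0|apply: mulr_gt0].
move=> P _ [supX supY] eps eps_gt0 x y Dx Dy.
have [w1 dw1 /ltW w1r] := sup_inf_enorm_lt supX rhos_r Dy.
have [w2 dw2 /ltW w2r] := sup_inf_enorm_lt supY rhos_r Dx.
have := feasible_min_le_Phi Dx dw1 w1r.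
have := Phi_le_feasible_max Dy dw2 w2r.
(* The existence of sub- and supergradients makes both optimal values finite,
   which reduces the claim to real arithmetic. *)
have /fineK minE : feasible_min y \is a fin_num.
  by rewrite feasible_minE; case: dw1.
have /fineK maxE : feasible_max x \is a fin_num.
  by rewrite feasible_maxE; case: dw2.
rewrite /eps_saddle /gap -minE -maxE.
move: (fine _) (fine _) => m M.
have := enorm_ge0 (resA x); have := enorm_ge0 (resB y).
move: (enorm _) (enorm _) => b a b_ge0 a_ge0.
rewrite -!EFinN -!EFinB -!EFinD !lee_fin => PhiM mPhi gap_le.
have S_le : (rho - r) * (a + b) <= eps by lra.
have {}S_le : a + b <= (rho - r)^-1 * eps by rewrite ler_pdivlMl.
have rS_le : r * (a + b) <= r / (rho - r) * eps.
  by rewrite -mulrA ler_pM2l.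
have ra_ge0 : 0 <= rho * a by rewrite mulr_ge0 //; lra.
have rb_ge0 : 0 <= rho * b by rewrite mulr_ge0 //; lra.
have S_ge0 : 0 <= (rho - r)^-1 * eps by lra.
have rS_ge0 : 0 <= r / (rho - r) * eps.
  by apply: le_trans rS_le; rewrite mulr_ge0 //; lra.
by rewrite !mulrDl mul1r; split=> //; [apply/andP; split|..]; lra.
Qed.
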